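(* Let $m\ge1$ and $n\ge1$ be integers, let $a_1,a_2,\dots,a_{2n-1},a_{2n}$ be an almost palindromic sequence of positive integers, and let $\overline{\mathcal G}=\overline{\mathcal G}[a_1,a_2,\dots,a_{2n-1},a_{2n}]$ be the corresponding band graph. Then the good $m$-dimer partition function $\overline{\mathcal Z}_{\overline{\mathcal G},m}(q)$ (with respect to the South-West weighting) is palindromic.
   Context: **Palindromic Laurent polynomial.** $f(q)\in\mathbb C[q^{\pm1}]$ is palindromic if $f(q^{-1})=q^{c}f(q)$ for some $c\in\mathbb Z$. **Almost palindromic sequence.** A sequence of positive integers $a_1,\dots,a_k$ ($k\ge2$) is almost palindromic if the subsequence $a_2,\dots,a_k$ is palindromic, i.e. $(a_2,\dots,a_k)=(a_k,\dots,a_2)$. **Snake graphs.** Let $a_1,\dots,a_k\ge 1$ be integers, $N=a_1+\dots+a_k$. The snake graph $\mathcal G[a_1,\dots,a_{k-1},a_k+1]$ is the planar graph (subgraph of the grid $\mathbb Z^2$) formed by the vertices and edges of $N$ unit square tiles $T_1,\dots,T_N$ as follows. The tiles are grouped consecutively into $k$ blocks, the $i$-th block having $a_i$ tiles (''the block of $a_i$''). $T_1$ has lower-left corner $(0,0)$. Define directions $d_0,d_1,\dots,d_N\in\{\text{North},\text{East}\}$ by $d_0=\text{North}$ and, for $1\le i\le N$: $d_i\neq d_{i-1}$ if $T_i$ is not the last tile of its block, and $d_i=d_{i-1}$ if $T_i$ is the last tile of its block. For $1\le i<N$, $T_{i+1}$ is the translate of $T_i$ by one unit in direction $d_i$. Vertices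 $(x,y)$ are colored black if $x+y$ is even and white otherwise. Let $a=(0,0)$ (black), $b=(1,0)$ (white) be the endpoints of the south edge of $T_1$. Let the exit edge be the north edge of $T_N$ if $d_N$ is North and the east edge of $T_N$ if $d_N$ is East; $a'$ denotes its black endpoint and $b'$ its white endpoint. **Band graphs.** For $a_1,\dots,a_{2n}\ge1$, the band graph $\overline{\mathcal G}[a_1,\dots,a_{2n}]$ is obtained from the snake graph $\mathcal G[a_1,\dots,a_{2n-1},a_{2n}+1]$ by gluing the edge $(ab)$ to the edge $(a'b')$ with $a$ identified with $a'$ and $b$ with $b'$ (parallel edges, if any arise, are kept distinct). **South-West weighting $\omega_{\mathrm{SW}}$.** For a tile in a block of odd index $a_{2i-1}$, each west or south edge of the tile lying on the boundary of the snake graph (i.e. belonging to only one tile) gets weight $q$, except the south edge of $T_1$. For a tile in a block of even index $a_{2i}$, each west or south edge of the tile lying on the boundary gets weight $q^{-1}$. All other edges, including the glued edge $(ab)=(a'b')$, get weight $1$. This induces a weighting on the edges of the band graph. **Good matchings and good $m$-dimer covers.** Let $P$ be a perfect matching of the underlying snake graph $\mathcal G[a_1,\dots,a_{2n-1},a_{2n}+1]$ containing at least one of $(ab)$, $(a'b')$. If $P$ contains exactly one of them, remove it and take the image of the remaining edges in $\overline{\mathcal G}$; if $P$ contains both, take the image of $P$ in $\overline{\mathcal G}$, with the glued edge included once. The perfect matchings of $\overline{\mathcal G}$ obtained this way are the good matchings. A good $m$-dimer cover of $\overline{\mathcal G}$ is a multiset $M$ of edges of $\overline{\mathcal G}$ with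 multiplicity function $\operatorname{mult}_M=\sum_{i=1}^m\operatorname{mult}_{P_i}$ for some (not necessarily distinct) good matchings $P_1,\dots,P_m$, where $\operatorname{mult}_{P_i}$ is the indicator function of $P_i$. Multisets with the same multiplicity function are the same good $m$-dimer cover. Let $\overline{\mathcal D}_{\overline{\mathcal G},m}$ be the set of good $m$-dimer covers. The good $m$-dimer partition function is $$\overline{\mathcal Z}_{\overline{\mathcal G},m}(q)=\sum_{M\in\overline{\mathcal D}_{\overline{\mathcal G},m}}\ \prod_{e\in E(\overline{\mathcal G})}\omega_{\mathrm{SW}}(e)^{\operatorname{mult}_M(e)}.$$ *)

(* Defs.v *)
From HB Require Import structures.
From mathcomp Require Import all_boot all_order all_algebra.
From mathcomp Require Import finmap reals complex.

Set Implicit Arguments.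
Unset Strict Implicit.
Unset Printing Implicit Defensive.

Import GRing.Theory.

Local Open Scope fset_scope.
Local Open Scope ring_scope.

(* Laurent polynomials in q, realized inside F(q). *)

Definition qvar (F : fieldType) : {fraction {poly F}} := tofrac 'X.

(* f(x) for the Laurent polynomial f(q) = q^{-k} p(q). *)
Definition laurent_eval (F : fieldType) (p : {poly F}) (k : nat)
    (x : {fraction {poly F}}) : {fraction {poly F}} :=
  (map_poly (fun c : F => tofrac c%:P) p).[x] * x ^- k.

(* f is a Laurent polynomial and f(q^{-1}) = q^c f(q) for some integer c;
   f(q^{-1}) does not depend on the way f is written, see laurent_evalV. *)
Definition palindromic (F : fieldType) (f : {fraction {poly F}}) : Prop :=
  exists (p : {poly F}) (k : nat),
    f = laurent_eval p k (qvar F) /\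
    exists c : int, laurent_eval p k (qvar F)^-1 = qvar F ^ c * f.

Lemma laurent_evalV (F : fieldType) (p1 p2 : {poly F}) (k1 k2 : nat) :
  laurent_eval p1 k1 (qvar F) = laurent_eval p2 k2 (qvar F) ->
  laurent_eval p1 k1 (qvar F)^-1 = laurent_eval p2 k2 (qvar F)^-1.
Proof.
pose iota : F -> {fraction {poly F}} := @tofrac {poly F} \o @polyC F.
have q0 : qvar F != 0 by rewrite tofrac_eq0 polyX_eq0.
have evq (p : {poly F}) : (map_poly iota p).[qvar F] = tofrac p.
  elim/poly_ind: p => [|p c IH]; first by rewrite !rmorph0 horner0.
  by rewrite rmorphD rmorphM /= map_polyX map_polyC hornerMXaddC IH rmorphD rmorphM.
rewrite /laurent_eval -/iota !evq => /eqP.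
rewrite eqr_div ?expf_neq0 // -!rmorphXn -!rmorphM tofrac_eq => /eqP E.
apply/eqP; rewrite eqr_div ?expf_neq0 ?invr_eq0 //; apply/eqP.
have /(congr1 (fun p => (map_poly iota p).[(qvar F)^-1])) := E.
by rewrite !rmorphM !rmorphXn /= map_polyX !hornerE.
Qed.

(* Edge labels in I keep parallel edges distinct. *)

Record multigraph (T I : choiceType) := Multigraph {
  vertices : {fset T};
  edges : {fset I};
  ends : I -> T * T
}.

Definition incident (T I : choiceType) (G : multigraph T I) (v : T) (e : I) :=
  (v == (ends G e).1) || (v == (ends G e).2).

Definition perfect_matchings (T I : choiceType) (G : multigraph T I) :
    {fset {fset I}} :=
  [fset P in fpowerset (edges G) |
    [forall v : vertices G, #|` [fset e in P | incident G (val v) e]| == 1%N]].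

(* Grid: a direction is true for North and false for East; the pair (p, d) is
   the unit edge going from the point p in the direction d. *)

Notation point := (nat * nat)%type.
Notation edge := (nat * nat * bool)%type.

Definition north := true.
Definition east := false.

Definition step (d : bool) (p : point) : point :=
  if d then (p.1, p.2.+1) else (p.1.+1, p.2).

Definition edge_ends (e : edge) : point * point := (e.1, step e.2 e.1).

Definition black (p : point) := ~~ odd (p.1 + p.2)%N.

(* A tile is given by its lower-left corner. *)
Definition south_edge (t : point) : edge := (t, east).
Definition west_edge (t : point) : edge := (t, north).
Definition north_edge (t : point) : edge := (step north t, east).
Definition east_edge (t : point) : edge := (step east t, north).

Definition tile_edges (t : point) : seq edge :=
  [:: south_edge t; west_edge t; north_edge t; east_edge t].

Definition tile_vertices (t : point) : seq point :=
  [:: t; step east t; step north t; step north (step east t)].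

(* The snake graph with blocks of a_1, ..., a_k tiles, where a = (a_1,...,a_k);
   this is G[a_1, ..., a_{k-1}, a_k + 1].  Tiles and blocks are numbered from 0:
   tile j is T_{j+1}, block b is the block of a_{b+1}. *)

Definition ntiles (a : seq nat) : nat := sumn a.

Definition block_of (a : seq nat) (j : nat) : nat := reshape_index a j.

Definition last_in_block (a : seq nat) (j : nat) : bool :=
  (reshape_offset a j).+1 == nth 0 a (block_of a j).

Fixpoint dir (a : seq nat) (i : nat) : bool :=
  if i is j.+1 then
    if last_in_block a j then dir a j else ~~ dir a j
  else north.

Fixpoint tile (a : seq nat) (j : nat) : point :=
  if j is j'.+1 then step (dir a j) (tile a j') else (0%N, 0%N).

Definition tiles (a : seq nat) : seq point := mkseq (tile a) (ntiles a).

Definition snake (a : seq nat) :=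
  Multigraph
    [fset v in flatten [seq tile_vertices t | t <- tiles a]]
    [fset e in flatten [seq tile_edges t | t <- tiles a]]
    edge_ends.

(* The edge (ab), with a = (0,0) and b = (1,0). *)
Definition entry_edge : edge := south_edge (0%N, 0%N).

(* The edge (a'b'). *)
Definition exit_edge (a : seq nat) : edge :=
  let t := tile a (ntiles a).-1 in
  if dir a (ntiles a) == north then north_edge t else east_edge t.

Definition exit_black (a : seq nat) : point :=
  let: (v, w) := edge_ends (exit_edge a) in if black v then v else w.

Definition exit_white (a : seq nat) : point :=
  let: (v, w) := edge_ends (exit_edge a) in if black v then w else v.

(* The gluing map; (0,0), (1,0) and (ab) represent the glued vertices and the
   glued edge. *)
Definition glue_vertex (a : seq nat) (v : point) : point :=
  if v == exit_black a then (0%N, 0%N)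
  else if v == exit_white a then (1%N, 0%N) else v.

Definition glue_edge (a : seq nat) (e : edge) : edge :=
  if e == exit_edge a then entry_edge else e.

Definition band (a : seq nat) :=
  Multigraph
    [fset glue_vertex a v | v in vertices (snake a)]
    [fset glue_edge a e | e in edges (snake a)]
    (fun e => (glue_vertex a (edge_ends e).1, glue_vertex a (edge_ends e).2)).

Definition matching_image (a : seq nat) (P : {fset edge}) : {fset edge} :=
  if (entry_edge \in P) && (exit_edge a \in P)
  then [fset glue_edge a e | e in P]
  else [fset glue_edge a e | e in P `\ entry_edge `\ exit_edge a].

Definition good_matchings (a : seq nat) : {fset {fset edge}} :=
  [fset Q in perfect_matchings (band a) |
    Q \in [fset matching_image a P | P in perfect_matchings (snake a)
             & (entry_edge \in P) || (exit_edge a \in P)]].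

(* A multiset of edges of the band graph, as its multiplicity function. *)
Notation edge_multiset a := {ffun edges (band a) -> nat}.

Definition matching_sum (a : seq nat) (m : nat)
    (P : {ffun 'I_m -> good_matchings a}) : edge_multiset a :=
  [ffun e => (\sum_(i < m) (val e \in val (P i)))%N].

Definition good_dimer_covers (a : seq nat) (m : nat) :
    {fset edge_multiset a} :=
  [fset matching_sum P | P in {ffun 'I_m -> good_matchings a}].

(* South-West weighting.  Boundary edges belong to exactly one tile.  Blocks
   being numbered from 0, the block of a_{2i-1} has an even number. *)

Definition on_boundary (a : seq nat) (e : edge) : bool :=
  count (fun t => e \in tile_edges t) (tiles a) == 1%N.

Definition sw_edge (a : seq nat) (b : bool) (e : edge) : bool :=
  [exists j : 'I_(ntiles a),
    [&& odd (block_of a j) == b, on_boundary a e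
      & e \in [:: west_edge (tile a j); south_edge (tile a j)]]].

Definition sw_weight (F : fieldType) (a : seq nat) (e : edge) :
    {fraction {poly F}} :=
  if e == entry_edge then 1
  else if sw_edge a false e then qvar F
  else if sw_edge a true e then (qvar F)^-1
  else 1.

(* The edges of the band graph are those of the snake graph other than (a'b'),
   the glued edge being (ab), of weight 1; so the weighting induced on the band
   graph is sw_weight itself. *)
Definition good_partition_function (F : fieldType) (a : seq nat) (m : nat) :
    {fraction {poly F}} :=
  \sum_(M <- good_dimer_covers a m)
    \prod_(e : edges (band a)) sw_weight F a (val e) ^+ M e.

Definition almost_palindromic (a : seq nat) : Prop :=
  [/\ (2 <= size a)%N, all (fun x => 0 < x)%N a & behead a = rev (behead a)].

(* Main.v *)
Require Import Defs.
From mathcomp Require Import all_boot all_order all_algebra.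
From mathcomp Require Import finmap reals complex.
From mathcomp Require Import zify ring.

(** Number the tiles from [0] to [N - 1], where [N] is the sum of [a], and place
    them on a circle. The proof identifies the good [m]-dimer covers of the band
    graph with the functions [f] from this circle to [{0, ..., m}] such that [f]
    decreases weakly from tile [k - 1] to tile [k] (cyclically) when [k] lies in
    the block of [a_1], [a_3], and so on, and increases weakly when [k] lies in
    one of the other blocks. Such an [f] is a bounded partition over a circular
    fence poset.

    For [m = 1], the vertex conditions of a perfect matching of the snake graph
    can be solved tile by tile (lemmas [tile_degrees] and [perfect_snakeP]): the
    matching is determined by its edges on the west or south boundary, and, up
    to a complementation which depends on the parity of the block, the
    indicator of these edges is a monotone function along the snake. The edge
    shared by two neighbouring tiles is in the matching exactly when their
    values differ. The matching contains (ab) or (a'b') exactly when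
    monotonicity also holds between the last tile and the first one
    ([fence_monotone_glued]), so good matchings correspond to the monotone
    functions on the circle with values in [{0, 1}]. For general [m], edge
    multiplicities are affine in the function, hence adding matchings is
    adding functions, and every bounded monotone function is the sum of the
    indicators of its superlevel sets ([good_dimer_coverP]).

    The South-West weight of the cover given by [f] is [q] to the power
    [sum f - m * M], where [M] is the number of tiles in the blocks of [a_2],
    [a_4], and so on ([cover_weight]). Now reflect the circle so that the block
    of [a_1] is mapped to itself. Since [a_2, a_3, ...] is palindromic of odd
    length, the other blocks are permuted with the parity of their indices
    preserved. The reflection reverses the direction of all comparisons, and so
    does the complementation of the values to [m]. The composition of the two
    is therefore an involution on the functions [f], and it maps the total
    [sum f] to [m * N - sum f]. This is the palindromicity of the partition
    function. *)

Set Implicit Arguments.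
Unset Strict Implicit.
Unset Printing Implicit Defensive.

(** * Blocks of tiles *)

Lemma sumn_take_succ (s : seq nat) r :
  sumn (take r.+1 s) = sumn (take r s) + nth 0 s r.
Proof.
case: (ltnP r (size s)) => hr; first by rewrite (take_nth 0 hr) sumn_rcons.
by rewrite !take_oversize ?(leqW hr) // nth_default // addn0.
Qed.

Lemma block_of_eq (s : seq nat) r j :
  sumn (take r s) <= j -> j < sumn (take r.+1 s) -> block_of s j = r.
Proof.
rewrite sumn_take_succ => h1 h2; rewrite /block_of.
have := @flatten_indexKl s r (j - sumn (take r s)).
rewrite /flatten_index subnKC //; apply; lia.
Qed.

Lemma block_ofP (s : seq nat) j : j < sumn s ->
  [/\ block_of s j < size s, sumn (take (block_of s j) s) <= j
    & j < sumn (take (block_of s j).+1 s)].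
Proof.
move=> hj; have := reshape_offsetP hj; have := reshape_indexK s j.
have hb := reshape_indexP hj.
rewrite /flatten_index sumn_take_succ /block_of => hE hlt; split=> //; lia.
Qed.

Lemma block_of_cons x (s : seq nat) i :
  block_of (x :: s) (x + i) = (block_of s i).+1.
Proof.
rewrite /block_of /reshape_index /=.
have -> : (x + i).+1 - x = i.+1 by lia.
by [].
Qed.

Lemma block_of_sumn (s : seq nat) : block_of s (sumn s) = size s.
Proof. by elim: s => //= x s IH; rewrite block_of_cons IH. Qed.

(** At the last tile this still holds, because [block_of s (sumn s)] is
    [size s] (see [block_of_sumn]); hence the parity of the block changes once
    more when the snake is closed up into a band. *)
Lemma block_of_succ (s : seq nat) j : all (fun x => 0 < x) s -> j < sumn s ->
  block_of s j.+1 = block_of s j + last_in_block s j.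
Proof.
move=> hpos hj; have [hb hle hlt] := block_ofP hj.
have hK := reshape_indexK s j.
(* The definition of [last_in_block] uses the zero of the ring structure of
   [nat] as default value. *)
have -> : last_in_block s j = ((reshape_offset s j).+1 == nth 0 s (block_of s j)).
  by [].
move: hb hle hlt hK; rewrite /flatten_index -/(block_of s j).
set b := block_of s j => hb hle hlt hK.
have hlt2 := hlt; rewrite sumn_take_succ in hlt2.
case: eqP => hoff /=; last first.
  by rewrite addn0; apply: block_of_eq; rewrite ?sumn_take_succ; lia.
have hj1 : j.+1 = sumn (take b.+1 s) by rewrite sumn_take_succ; lia.
rewrite addn1; case: (ltnP b.+1 (size s)) => hb1.
  apply: block_of_eq; rewrite ?hj1 // (sumn_take_succ _ b.+1).
  by have := all_nthP 0 hpos _ hb1; lia.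
have -> : j.+1 = sumn s by rewrite hj1 take_oversize.
by rewrite block_of_sumn; lia.
Qed.

Lemma block_of_rev (s : seq nat) i : i < sumn s ->
  block_of (rev s) (sumn s - i.+1) = size s - (block_of s i).+1.
Proof.
move=> hi; have [hb hle hlt] := block_ofP hi.
set b := block_of s i in hb hle hlt *.
have hdrop r : sumn (drop r s) = sumn s - sumn (take r s).
  by rewrite -[in sumn s](cat_take_drop r s) sumn_cat addKn.
have htake r : r <= size s -> sumn (take r s) <= sumn s.
  by rewrite -[in sumn s](cat_take_drop r s) sumn_cat leq_addr.
have h1 := htake _ hb; have h2 := htake _ (ltnW hb).
apply: block_of_eq.
  rewrite take_rev sumn_rev.
  have -> : size s - (size s - b.+1) = b.+1 by lia.
  by rewrite hdrop; lia.
rewrite take_rev sumn_rev.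
have -> : size s - (size s - b.+1).+1 = b by lia.
by rewrite hdrop; lia.
Qed.

Definition block_parity (a : seq nat) (k : nat) : bool := odd (block_of a k).

(** Let the tiles lie on a circle of length [sumn a]. The reflection below maps
    the first block to itself and reverses the other ones, which are arranged
    palindromically. As they are odd in number, reversing their order does not
    change the parity of their positions. *)
Lemma block_parity_reflect a k (hpal : behead a = rev (behead a)) :
  ~~ odd (size a) -> 1 < size a -> k < sumn a ->
  block_parity a (if k < head 0 a then head 0 a - k.+1
                  else sumn a + head 0 a - k.+1) = block_parity a k.
Proof.
case: a hpal => // x s /= hpal; rewrite negbK => hodd _ hk.
have first i : i < x -> block_of (x :: s) i = 0.
  by move=> hi; apply: block_of_eq; rewrite /= ?take0 /= ?addn0.
rewrite /block_parity; case: ltnP => hkx; first by rewrite !first //; lia.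
rewrite -(subnKC hkx); set i := k - x.
have hi : i < sumn s by rewrite /i; lia.
have -> : x + sumn s + x - (x + i).+1 = x + (sumn s - i.+1) by lia.
rewrite !block_of_cons {1}hpal block_of_rev //.
have [hb _ _] := block_ofP hi; lia.
Qed.

(** * Tiles and edges of a snake graph *)

(** Each step raises the level by one, so [k] is the level of the lower-left
    corner of tile [k], and the level of its starting point nearly determines
    an edge of the snake. *)
Definition level (v : nat * nat) := v.1 + v.2.

Lemma level_step d v : level (step d v) = (level v).+1.
Proof. by case: d; rewrite /level /=; lia. Qed.

Lemma level_tile a k : level (tile a k) = k.
Proof. by elim: k => //= k IH; rewrite level_step IH. Qed.

Lemma step_neq d v : step (~~ d) v != step d v.
Proof. by case: d v => -[x y]; rewrite xpair_eqE /=; apply/negP; lia. Qed.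

Lemma stepC d v : step (~~ d) (step d v) = step d (step (~~ d) v).
Proof. by case: d. Qed.

Lemma tileS a k : tile a k.+1 = step (dir a k.+1) (tile a k).
Proof. by []. Qed.

Arguments dir : simpl never.
Arguments tile : simpl never.

(** Tile [k] is entered through [rung a k] and left through [rung a k.+1], and
    its other two edges are [lower a k], on the west or south side, and
    [upper a k], on the east or north side. With [N] tiles, [rung a 0] is the
    edge (ab) and [rung a N] is the edge (a'b'). *)
Definition rung a k : nat * nat * bool := (tile a k, ~~ dir a k).
Definition lower a k : nat * nat * bool := (tile a k, dir a k).
Definition upper a k : nat * nat * bool :=
  (step (~~ dir a k.+1) (tile a k), dir a k.+1).

Lemma rung_inj a : injective (rung a).
Proof. by move=> k l /(congr1 (level \o fst)) /=; rewrite !level_tile. Qed.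

Lemma rung_neq_lower a k l : rung a k != lower a l.
Proof.
apply/eqP => h; have := congr1 (level \o fst) h; rewrite /= !level_tile => hk.
by have := congr1 snd h; rewrite hk /=; case: (dir a l).
Qed.

Lemma rung_neq_upper a k l : rung a k != upper a l.
Proof.
apply/eqP => h; have := congr1 (level \o fst) h.
rewrite /= level_tile level_step level_tile => hk.
have /eqP := congr1 fst h; rewrite hk /= tileS eq_sym.
by rewrite (negPf (step_neq _ _)).
Qed.

Lemma lower_inj a : injective (lower a).
Proof. by move=> k l /(congr1 (level \o fst)) /=; rewrite !level_tile. Qed.

Lemma lower_neq_upper a k l : lower a k != upper a l.
Proof.
apply/eqP => h; have := congr1 (level \o fst) h.
rewrite /= level_tile level_step level_tile => hk.
have /eqP := congr1 fst h; rewrite hk /= tileS eq_sym.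
by rewrite (negPf (step_neq _ _)).
Qed.

Lemma tile_edgesE a k e : e \in tile_edges (tile a k) =
  [|| e == lower a k, e == rung a k, e == upper a k | e == rung a k.+1].
Proof.
rewrite !inE /lower /rung /upper tileS /south_edge /west_edge /north_edge.
rewrite /east_edge /north /east.
case: (dir a k); case: (dir a k.+1); rewrite /negb.
all: by do 4![case: (e == _) => /=]; rewrite ?orbT.
Qed.

Lemma snake_edgeP a e :
  reflect (exists2 k, k < sumn a &
     [|| e == lower a k, e == rung a k, e == upper a k | e == rung a k.+1])
    (e \in edges (snake a)).
Proof.
apply: (iffP idP).
  rewrite in_fset => /flatten_mapP[t /(nthP (0,0))[k]].
  rewrite size_mkseq => hk; rewrite nth_mkseq // => <-.
  by rewrite tile_edgesE; exists k.
move=> [k hk he]; rewrite in_fset; apply/flatten_mapP; exists (tile a k).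
  by apply/mapP; exists k => //; rewrite mem_iota.
by rewrite tile_edgesE.
Qed.

Lemma entry_edgeE a : entry_edge = rung a 0.
Proof. by []. Qed.

Lemma exit_edgeE a : 0 < sumn a -> exit_edge a = rung a (sumn a).
Proof.
rewrite /exit_edge /ntiles /rung; case: (sumn a) => // N _ /=.
by rewrite tileS; case: (dir a N.+1).
Qed.

(** * Perfect matchings of a snake graph *)

Lemma snake_edge_cases a e : e \in edges (snake a) ->
  [\/ e = rung a (level e.1) /\ level e.1 <= sumn a,
      e = lower a (level e.1) /\ level e.1 < sumn a
    | exists k, [/\ level e.1 = k.+1, k < sumn a & e = upper a k]].
Proof.
case/snake_edgeP => k hk; case/or4P => /eqP ->.
- by apply: Or32; rewrite level_tile.
- by apply: Or31; rewrite level_tile ltnW.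
- by apply: Or33; exists k; rewrite level_step level_tile.
- by apply: Or31; rewrite level_tile.
Qed.

(** A vertex one level above tile [k] lies on at most two edges coming from
    below: [lower a k] at one of the two vertices of that level, [rung a k] and
    [upper a k.-1] at the other one (see [edge_of_step_ndir]). *)
Lemma edge_of_step_dir a e k : e \in edges (snake a) ->
  step e.2 e.1 = step (dir a k) (tile a k) -> e = lower a k.
Proof.
move=> he hs; have hl : level e.1 = k.
  by have := congr1 level hs; rewrite !level_step level_tile => -[].
case: (snake_edge_cases he) => [[]|[]|[k' []]]; rewrite hl => // hE h2.
  by move: hs; rewrite hE => /eqP; rewrite (negPf (step_neq _ _)).
move=> hu; move: hs; rewrite hu hE /= -stepC => /eqP.
by rewrite (negPf (step_neq _ _)).
Qed.

Lemma edge_of_step_ndir a e k : e \in edges (snake a) ->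
  step e.2 e.1 = step (~~ dir a k) (tile a k) ->
  e = rung a k \/ exists2 k', k = k'.+1 & e = upper a k'.
Proof.
move=> he hs; have hl : level e.1 = k.
  by have := congr1 level hs; rewrite !level_step level_tile => -[].
case: (snake_edge_cases he) => [[]|[]|[k' []]]; rewrite hl => // hE h2.
- by left.
- by move: hs; rewrite hE => /eqP; rewrite eq_sym (negPf (step_neq _ _)).
- by right; exists k'.
Qed.

(** Thus the exit edge can be treated as the entrance to one more tile whose
    lower edge is in no matching. *)
Lemma lower_exit_notin a : lower a (sumn a) \notin edges (snake a).
Proof.
apply/negP => /snake_edge_cases; rewrite level_tile ltnn.
case=> [[] | [] | [k [hk _]]] //.
  by case=> h; case: (dir a _) h.
by case; rewrite hk tileS => /eqP; rewrite eq_sym (negPf (step_neq _ _)).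
Qed.

Lemma upper_turned_notin a k :
  ((upper a k).1, ~~ dir a k.+1) \notin edges (snake a).
Proof.
apply/negP => /snake_edge_cases; rewrite level_step level_tile.
case=> [[h _] | [h _] | [k' [[<-] _ h]]].
- by have /eqP := congr1 fst h; rewrite (negPf (step_neq _ _)).
- by have /eqP := congr1 fst h; rewrite (negPf (step_neq _ _)).
- have h2 : ~~ dir a k.+1 = dir a k.+1 := congr1 snd h.
  by case: (dir a k.+1) h2.
Qed.

(** The number of edges of [P] at [v]; unlike [incident], it does not mention
    the snake that contains [P]. *)
Definition degree (P : {fset nat * nat * bool}) (v : nat * nat) : nat :=
  #|` [fset e in P | (v == e.1) || (v == step e.2 e.1)]%fset|.

Lemma degree_count (P : {fset nat * nat * bool}) v s :
  uniq s -> (forall e, e \in P -> (v == e.1) || (v == step e.2 e.1) = (e \in s)) ->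
  degree P v = count [in P] s.
Proof.
move=> hu hs; rewrite /degree.
have -> : [fset e in P | (v == e.1) || (v == step e.2 e.1)]%fset
    = [fset e in filter [in P] s]%fset.
  apply/fsetP => e; rewrite !inE /= mem_filter.
  by case: (boolP (e \in P)) => //= /hs.
by rewrite card_fseq undup_id ?filter_uniq // size_filter.
Qed.

Section Degrees.

Variables (a : seq nat) (P : {fset nat * nat * bool}).
Hypothesis sub : (P `<=` edges (snake a))%fset.

Let P_snake e : e \in P -> e \in edges (snake a).
Proof. exact: (fsubsetP sub). Qed.

(** Membership of [upper a k.-1], read as false when there is no tile [k.-1]. *)
Definition upper_pred k : bool := if k is k'.+1 then upper a k' \in P else false.

(** The edges going up from a vertex [v] are [(v, true)] and [(v, false)]; their
    number in [P] depends on whether [v] is the corner of a tile or the other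
    vertex of its level, as in [up_upper]. *)
Lemma up_tile k :
  count [in P] [:: (tile a k, true); (tile a k, false)] =
  (lower a k \in P) + (rung a k \in P).
Proof. by rewrite /lower /rung /=; case: (dir a k) => /=; lia. Qed.

Lemma up_upper k (v := step (~~ dir a k.+1) (tile a k)) :
  count [in P] [:: (v, true); (v, false)] = (upper a k \in P).
Proof.
have : (v, ~~ dir a k.+1) \notin P.
  by apply: contra (@P_snake _) _; exact: upper_turned_notin.
by rewrite /upper /= -/v; case: (dir a k.+1) => /= /negPf ->; lia.
Qed.

Lemma vedge_uniq (v : nat * nat) : uniq [:: (v, true); (v, false)].
Proof. by rewrite /= inE xpair_eqE andbF. Qed.

Lemma mem_vedge (v : nat * nat) e :
  (e \in [:: (v, true); (v, false)]) = (v == e.1).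
Proof.
by rewrite !inE; case: e => u []; rewrite !xpair_eqE /= eq_sym ?andbT ?andbF ?orbF.
Qed.

Lemma degree_start : degree P (tile a 0) = (lower a 0 \in P) + (rung a 0 \in P).
Proof.
rewrite -up_tile; apply: degree_count => [|e _]; first exact: vedge_uniq.
rewrite mem_vedge; case: (_ == e.1) => //=.
by apply/eqP => /(congr1 level); rewrite level_step.
Qed.

Lemma degree_dir k (v := step (dir a k) (tile a k)) :
  degree P v = count [in P] [:: (v, true); (v, false)] + (lower a k \in P).
Proof.
have -> : nat_of_bool (lower a k \in P) = count [in P] [:: lower a k].
  by rewrite /= addn0.
rewrite -count_cat; apply: degree_count.
  rewrite cat_uniq vedge_uniq /= !orbF mem_vedge andbT.
  by apply/eqP => /(congr1 level); rewrite level_step /=; lia.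
move=> e he; rewrite mem_cat mem_vedge; congr orb; rewrite inE eq_sym.
by apply/eqP/eqP => [/(edge_of_step_dir (P_snake he)) | ->].
Qed.

Lemma degree_ndir k (v := step (~~ dir a k) (tile a k)) :
  degree P v = count [in P] [:: (v, true); (v, false)]
               + ((rung a k \in P) + upper_pred k).
Proof.
set s := rung a k :: (if k is k'.+1 then [:: upper a k'] else [::]).
have -> : (rung a k \in P) + upper_pred k = count [in P] s.
  by rewrite /s; case: k @v @s => [|k] /=; rewrite ?addn0.
have sP e : e \in s -> v = step e.2 e.1.
  rewrite inE; case/orP => [/eqP -> //|].
  by case: k @v @s => [|k] v s //; rewrite inE => /eqP ->; rewrite /v /= -stepC.
rewrite -count_cat; apply: degree_count.
  rewrite cat_uniq vedge_uniq andTb; apply/andP; split.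
    apply/hasPn => e /sP hv; rewrite mem_vedge hv.
    by apply/eqP => /(congr1 level); rewrite level_step; lia.
  rewrite /s; clear v s sP; case: k => [|k] //=; rewrite inE andbT.
  by apply/eqP => /(congr1 fst)/eqP; rewrite eq_sym (negPf (step_neq _ _)).
move=> e he; rewrite mem_cat mem_vedge; congr orb.
apply/eqP/idP => [|/sP //] /esym /(edge_of_step_ndir (P_snake he)).
rewrite /s; case=> [->|[k' -> ->]]; first by rewrite inE eqxx.
by rewrite !inE eqxx orbT.
Qed.

(** Exactly one edge of [P] joins the levels [k] and [k.+1]. For a perfect
    matching this holds all along the snake: level [0] has one vertex, and each
    of the levels from [1] to [sumn a] has two, one of which is matched
    downwards and therefore the other one upwards. *)
Definition balanced k := (rung a k \in P) + (lower a k \in P) + upper_pred k == 1.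

(** The two vertices [v] and [v'] of level [k.+1] carry the edges [lower a k],
    [rung a k], [upper a k.-1] from below and [upper a k], [lower a k.+1],
    [rung a k.+1] from above. If the path turns at tile [k], then [lower a k]
    and [upper a k] are alone at one vertex, so that exactly one of them is in
    [P]; if it goes straight, they lie at different vertices and are in [P]
    together. In both cases the remaining condition is the invariant at
    [k.+1]. *)
Lemma tile_degrees k : balanced k ->
  (degree P (step true (tile a k)) == 1) && (degree P (step false (tile a k)) == 1)
  = ((upper a k \in P) == (lower a k \in P) (+) (dir a k != dir a k.+1))
    && balanced k.+1.
Proof.
rewrite /balanced => hk.
have -> : (degree P (step true (tile a k)) == 1)
       && (degree P (step false (tile a k)) == 1) =
   (degree P (step (dir a k) (tile a k)) == 1)
       && (degree P (step (~~ dir a k) (tile a k)) == 1).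
  by case: (dir a k) => //=; rewrite andbC.
rewrite degree_dir degree_ndir.
have hu := up_tile k.+1; have hn := up_upper k; rewrite tileS in hu.
have [E|E] : dir a k.+1 = dir a k \/ dir a k.+1 = ~~ dir a k.
  by case: (dir a k) (dir a k.+1) => -[]; auto.
- rewrite E in hu hn; rewrite hu hn E eqxx /=.
  case: (rung a k \in P) hk; case: (lower a k \in P);
  case: (upper_pred k); case: (upper a k \in P) => //;
  by case: (rung a k.+1 \in P); case: (lower a k.+1 \in P).
- rewrite E negbK in hu hn; rewrite hu hn E.
  have -> : dir a k != ~~ dir a k by case: (dir a k).
  rewrite /=.
  case: (rung a k \in P) hk; case: (lower a k \in P);
  case: (upper_pred k); case: (upper a k \in P) => //;
  by case: (rung a k.+1 \in P); case: (lower a k.+1 \in P).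
Qed.

Lemma degree_top (N := sumn a) : balanced N ->
  degree P (step (~~ dir a N) (tile a N)) = 1.
Proof.
rewrite /balanced degree_ndir => /eqP hN.
have hl : lower a N \in P = false.
  by apply/negbTE; apply: contra (@P_snake _) _; exact: lower_exit_notin.
rewrite hl in hN; rewrite -[RHS]hN /=.
have hout b : (step (~~ dir a N) (tile a N), b) \in P = false.
  apply/negbTE/negP => /P_snake /snake_edge_cases; rewrite level_step level_tile /=.
  by case=> [[_ h]|[_ h]|[k [[hk] h _]]]; rewrite -/N in h; lia.
rewrite !hout; lia.
Qed.

End Degrees.

Lemma snake_vertexP a v : 0 < sumn a ->
  reflect [\/ v = tile a 0, exists2 k, k < sumn a & exists b, v = step b (tile a k)
    | v = step (~~ dir a (sumn a)) (tile a (sumn a))]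
  (v \in vertices (snake a)).
Proof.
move=> hN.
have top k : step north (step east (tile a k)) =
    step (~~ dir a k.+1) (tile a k.+1).
  by rewrite tileS; case: (dir a k.+1).
apply: (iffP idP).
  rewrite in_fset => /flatten_mapP[t /(nthP (0,0))[k]].
  rewrite size_mkseq => hk; rewrite nth_mkseq // => <-.
  rewrite !inE; case/or4P => /eqP ->.
  - case: k hk => [|k] hk; first exact: Or31.
    by apply: Or32; exists k; [exact: ltnW | exists (dir a k.+1)].
  - by apply: Or32; exists k => //; exists east.
  - by apply: Or32; exists k => //; exists north.
  - rewrite top; case: (ltngtP k.+1 (sumn a)) => h; last by rewrite h; exact: Or33.
      by apply: Or32; exists k.+1 => //; eexists.
    by rewrite /ntiles in hk; lia.
have mk k : k < sumn a -> tile a k \in tiles a.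
  by move=> hk; apply/mapP; exists k => //; rewrite mem_iota.
rewrite in_fset => hv; apply/flatten_mapP; case: hv => [->|[k hk [b ->]]|->].
- by exists (tile a 0); rewrite ?mk // !inE eqxx.
- by exists (tile a k); rewrite ?mk // !inE; case: b; rewrite eqxx ?orbT.
- exists (tile a (sumn a).-1); rewrite ?mk ?prednK //.
  by rewrite -{1 2}(prednK hN) -top !inE eqxx !orbT.
Qed.

Lemma perfect_matchingsP (T I : choiceType) (G : multigraph T I) P :
  reflect ((P `<=` edges G)%fset /\ forall v, v \in vertices G ->
             #|` [fset e in P | incident G v e]%fset| = 1)
    (P \in perfect_matchings G).
Proof.
rewrite /perfect_matchings in_fset !inE /= fpowersetE.
apply: (iffP andP) => -[sub hv]; split=> //.
  by move=> v vG; apply/eqP; exact: (forallP hv [` vG]%fset).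
by apply/forallP => -[v vG] /=; rewrite hv.
Qed.

(** By induction along the snake, using [tile_degrees]. In particular the edges
    [lower a k] of a perfect matching determine all its other edges. *)
Lemma perfect_snakeP a P : 0 < sumn a ->
  reflect [/\ (P `<=` edges (snake a))%fset,
     forall k, k < sumn a -> (upper a k \in P)
        = (lower a k \in P) (+) (dir a k != dir a k.+1)
   & forall k, k <= sumn a -> balanced a P k]
  (P \in perfect_matchings (snake a)).
Proof.
move=> hN; apply: (iffP (perfect_matchingsP _ _)) => [[sub hdeg']|[sub hup hbal]].
  have hdeg v : v \in vertices (snake a) -> degree P v == 1.
    by move=> hv; apply/eqP; exact: hdeg'.
  have bal0 : balanced a P 0.
    have := hdeg (tile a 0); rewrite degree_start //.
    rewrite /balanced addn0 addnC; apply.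
    by apply/snake_vertexP => //; exact: Or31.
  have hstep k : k < sumn a -> balanced a P k ->
    ((upper a k \in P) == (lower a k \in P) (+) (dir a k != dir a k.+1))
      && balanced a P k.+1.
    move=> hk hb; rewrite -tile_degrees // !hdeg //.
    1,2: by apply/snake_vertexP => //; apply: Or32; exists k => //; eexists.
  have hbal k : k <= sumn a -> balanced a P k.
    by elim: k => // k IH hk; have /andP[] := hstep k hk (IH (ltnW hk)).
  split=> // k hk.
  by have /andP[/eqP] := hstep k hk (hbal k (ltnW hk)).
split=> // v hv; change (degree P v = 1); apply/eqP.
case/snake_vertexP: hv => // [->|[k hk [b ->]]|->].
- by rewrite degree_start //; have := hbal 0 isT; rewrite /balanced addn0 addnC.
- have := tile_degrees sub (hbal k (ltnW hk)).
  by rewrite hup // eqxx hbal //= => /andP[]; case: b.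
- by rewrite degree_top // hbal.
Qed.

(** * Gluing a snake graph into a band graph *)

Lemma rung_snake a k : k <= sumn a -> 0 < sumn a -> rung a k \in edges (snake a).
Proof.
move=> hk hN; apply/snake_edgeP; case: k hk => [|k] hk.
  by exists 0; rewrite // eqxx orbT.
by exists k; rewrite // eqxx !orbT.
Qed.

Lemma lower_snake a k : k < sumn a -> lower a k \in edges (snake a).
Proof. by move=> hk; apply/snake_edgeP; exists k; rewrite // eqxx. Qed.

Lemma upper_snake a k : k < sumn a -> upper a k \in edges (snake a).
Proof. by move=> hk; apply/snake_edgeP; exists k; rewrite // eqxx !orbT. Qed.

Lemma entry_neq_exit a : 0 < sumn a -> entry_edge != exit_edge a.
Proof.
move=> hN; rewrite (entry_edgeE a) exit_edgeE // (inj_eq (@rung_inj a)); lia.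
Qed.

Lemma mem_band_edges a e : 0 < sumn a ->
  (e \in edges (band a)) = (e \in edges (snake a)) && (e != exit_edge a).
Proof.
move=> hN; have hne := entry_neq_exit hN.
apply/imfsetP/andP => [[x xs ->]|[he hx]].
  rewrite /glue_edge; case: eqP => [_|/eqP //].
  by rewrite hne (entry_edgeE a) rung_snake.
by exists e => //; rewrite /glue_edge (negPf hx).
Qed.

Lemma mem_matching_image a (P : {fset nat * nat * bool}) e : 0 < sumn a ->
  (e \in matching_image a P) =
  if e == entry_edge then (entry_edge \in P) && (exit_edge a \in P)
  else (e \in P) && (e != exit_edge a).
Proof.
move=> hN; have hne := entry_neq_exit hN.
rewrite /matching_image; case: ifP => hb.
  apply/imfsetP/idP => [[x /= xP ->]|].
    rewrite /glue_edge; case: (x =P exit_edge a) => [|/eqP] hx.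
      by rewrite eqxx.
    by case: ifP => // _; rewrite xP.
  case: eqP => [-> _|_ /andP[eP hx]].
    by exists (exit_edge a); rewrite ?/glue_edge ?eqxx //; case/andP: hb.
  by exists e => //; rewrite /glue_edge (negPf hx).
apply/imfsetP/idP => [[x /=]|].
  rewrite !inE => /and3P[h1 h2 xP] ->.
  by rewrite /glue_edge (negPf h1) (negPf h2) xP h1.
case: eqP => [//|/eqP h0 /andP[eP hx]].
by exists e; rewrite ?inE /= ?hx ?h0 // /glue_edge (negPf hx).
Qed.

(** With at least two tiles, these levels keep the ends of the exit edge apart
    from those of the entry edge, whose levels are [0] and [1]; so the gluing
    identifies vertices in two disjoint pairs. *)
Lemma exit_endsP a : 0 < sumn a ->
  [/\ sumn a <= level (exit_black a), sumn a <= level (exit_white a),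
      exit_black a != exit_white a
    & forall v, (v == (exit_edge a).1) || (v == step (exit_edge a).2 (exit_edge a).1)
        = (v == exit_black a) || (v == exit_white a)].
Proof.
move=> hN; rewrite /exit_black /exit_white /edge_ends exit_edgeE //.
have hl := level_step (~~ dir a (sumn a)) (tile a (sumn a)).
have hl' := level_tile a (sumn a).
rewrite /rung /=; set d := dir _ _ in hl *; set t := tile _ _ in hl hl' *.
have hne : t != step (~~ d) t by apply/eqP => h; rewrite -h in hl; lia.
case: ifP => _; first by split; rewrite // ?hl ?hl'.
split=> [|||v]; rewrite ?hl ?hl' //; first by rewrite eq_sym.
exact: orbC.
Qed.

Lemma perfect_unique a P v : P \in perfect_matchings (snake a) ->
  v \in vertices (snake a) ->
  exists2 e, e \in P & forall e', e' \in P -> incident (snake a) v e' = (e' == e).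
Proof.
case/perfect_matchingsP => sub hP hv.
have /eqP/cardfs1P[e he] := hP v hv.
have hin e' : (e' \in P) && incident (snake a) v e' = (e' == e).
  by have := congr1 (fun A : {fset _} => e' \in A) he; rewrite !inE.
exists e; first by have := hin e; rewrite eqxx => /andP[].
by move=> e' eP; have := hin e'; rewrite eP.
Qed.

(** Before gluing, [u] and [u'] are each on one edge of [P]. If [P] contains both
    the entry and the exit edge, these two become the one glued edge; if it
    contains only one of them, that edge is removed and the edge of [P] at the
    other vertex remains. *)
Lemma glued_vertex_matched a P u u' : 0 < sumn a ->
  P \in perfect_matchings (snake a) ->
  (entry_edge \in P) || (exit_edge a \in P) ->
  u \in vertices (snake a) -> u' \in vertices (snake a) ->
  incident (snake a) u entry_edge -> ~~ incident (snake a) u' entry_edge ->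
  incident (snake a) u' (exit_edge a) -> ~~ incident (snake a) u (exit_edge a) ->
  #|` [fset e in matching_image a P |
       incident (snake a) u e || incident (snake a) u' e]%fset| = 1.
Proof.
move=> hN hP hor hu hu' uE u'E u'X uX.
have [e1 e1P h1] := perfect_unique hP hu.
have [e2 e2P h2] := perfect_unique hP hu'.
have hne := entry_neq_exit hN.
pose g := if entry_edge \in P then if exit_edge a \in P then entry_edge else e2
          else e1.
apply/eqP/cardfs1P; exists g; apply/fsetP => e; rewrite in_fset1 !inE /=.
rewrite mem_matching_image // /g.
case: (boolP (entry_edge \in P)) hor => EP; case: (boolP (exit_edge a \in P)) => XP //= _.
- have e1E : e1 = entry_edge by have := h1 _ EP; rewrite uE => /esym/eqP.
  have e2X : e2 = exit_edge a by have := h2 _ XP; rewrite u'X => /esym/eqP.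
  case: (e =P entry_edge) => [->|/eqP nE]; first by rewrite uE.
  case: (boolP (e \in P)) => //= eP; rewrite h1 // h2 // e1E e2X (negPf nE).
  by case: eqP.
- have e1E : e1 = entry_edge by have := h1 _ EP; rewrite uE => /esym/eqP.
  case: (e =P entry_edge) => [->|/eqP nE] /=.
    by apply/esym/eqP => h; move: u'E; rewrite h2 // h eqxx.
  case: (boolP (e \in P)) => //= eP; last by apply/esym/eqP => h; rewrite h e2P in eP.
  rewrite h1 // h2 // e1E (negPf nE) /=; case: (e =P e2) => [->|]; rewrite ?andbF // andbT.
  by apply/eqP => h; rewrite -h e2P in XP.
have e2X : e2 = exit_edge a by have := h2 _ XP; rewrite u'X => /esym/eqP.
case: (e =P entry_edge) => [->|/eqP nE] /=.
  by apply/esym/eqP => h; rewrite h e1P in EP.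
case: (boolP (e \in P)) => //= eP; last by apply/esym/eqP => h; rewrite h e1P in eP.
rewrite h1 // h2 // e2X; case: (e =P e1) => [->|] /=; rewrite ?andbT ?andNb //.
by apply/eqP => h; move: uX; rewrite -h h1 // eqxx.
Qed.

(** Only the glued vertices see a difference between [P] and its image; they are
    dealt with by [glued_vertex_matched]. *)
Lemma matching_image_perfect a P : 1 < sumn a ->
  P \in perfect_matchings (snake a) ->
  (entry_edge \in P) || (exit_edge a \in P) ->
  matching_image a P \in perfect_matchings (band a).
Proof.
move=> hN1 hP hor; have hN := ltnW hN1.
have [lb lw bw hX] := exit_endsP hN.
have /perfect_matchingsP[sub _] := hP.
have lev v v' : level v != level v' -> v != v' by apply: contraNneq => ->.
have l00 : level (0, 0) = 0 by [].
have l10 : level (1, 0) = 1 by [].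
have b0 : exit_black a != (0, 0) by apply: lev; rewrite l00; lia.
have b1 : exit_black a != (1, 0) by apply: lev; rewrite l10; lia.
have w0 : exit_white a != (0, 0) by apply: lev; rewrite l00; lia.
have w1 : exit_white a != (1, 0) by apply: lev; rewrite l10; lia.
have incX v : incident (snake a) v (exit_edge a)
    = (v == exit_black a) || (v == exit_white a) by exact: hX.
have incE v : incident (snake a) v entry_edge = (v == (0, 0)) || (v == (1, 0)).
  by [].
have endV v e : e \in edges (snake a) -> incident (snake a) v e ->
    v \in vertices (snake a).
  case/snake_edgeP => k hk; rewrite -tile_edgesE => he hv.
  rewrite in_fset; apply/flatten_mapP; exists (tile a k).
    by apply/mapP; exists k; rewrite // mem_iota.
  move: he hv; rewrite !inE /incident /= => /or4P[] /eqP -> /= /orP[] /eqP ->;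
    by rewrite ?eqxx ?orbT.
have EV := endV _ _ (rung_snake (leq0n _) hN).
have XV : forall v, incident (snake a) v (exit_edge a) -> v \in vertices (snake a).
  by move=> v; apply: endV; rewrite exit_edgeE // rung_snake.
apply/perfect_matchingsP; split.
  apply/fsubsetP => e; rewrite mem_matching_image // mem_band_edges //.
  case: eqP => [-> _|_ /andP[eP ->]]; last by rewrite (fsubsetP sub).
  by rewrite entry_neq_exit // (entry_edgeE a) rung_snake.
move=> v /imfsetP[v0 /= hv0 ->].
have glueb e u u' : (forall w, (u == glue_vertex a w) = (u == w) || (u' == w)) ->
    incident (band a) u e = incident (snake a) u e || incident (snake a) u' e.
  by move=> h; rewrite /incident /= !h orbACA.
have glued u u' : u \in [:: (0, 0); (1, 0)] -> u' \in [:: exit_black a; exit_white a] ->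
    (forall w, (u == glue_vertex a w) = (u == w) || (u' == w)) ->
    #|` [fset e in matching_image a P | incident (band a) u e]%fset| = 1.
  rewrite !inE => hu hu' hg; have uu' : (u' == (0, 0)) || (u' == (1, 0)) = false.
    by case/orP: hu' => /eqP ->; apply/negbTE; rewrite negb_or ?b0 ?b1 ?w0 ?w1.
  have u'u : (u == exit_black a) || (u == exit_white a) = false.
    case/orP: hu => /eqP ->; rewrite eq_sym [_ == exit_white a]eq_sym.
      by apply/negbTE; rewrite negb_or b0.
    by apply/negbTE; rewrite negb_or b1.
  rewrite (_ : [fset e in _ | _]%fset = [fset e in matching_image a P |
       incident (snake a) u e || incident (snake a) u' e]%fset); last first.
    by apply/fsetP => e; rewrite !inE /= (glueb _ _ u').
  have uE : incident (snake a) u entry_edge by rewrite incE.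
  have u'X : incident (snake a) u' (exit_edge a) by rewrite incX.
  apply: (glued_vertex_matched hN hP hor (EV _ uE) (XV _ u'X) uE _ u'X).
    by rewrite incE uu'.
  by rewrite incX u'u.
have glued0 : #|` [fset e in matching_image a P | incident (band a) (0, 0) e]%fset| = 1.
  apply: (glued _ (exit_black a)); rewrite ?inE ?eqxx // => w; rewrite /glue_vertex.
  case: (w =P exit_black a) => [->|/eqP wb]; first by rewrite !eqxx orbT.
  rewrite [exit_black a == w]eq_sym (negPf wb) orbF.
  by case: (w =P exit_white a) => [->|//]; rewrite [RHS]eq_sym (negPf w0).
have glued1 : #|` [fset e in matching_image a P | incident (band a) (1, 0) e]%fset| = 1.
  apply: (glued _ (exit_white a)); rewrite ?inE ?eqxx ?orbT // => w.
  rewrite /glue_vertex.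
  case: (w =P exit_black a) => [->|/eqP wb].
    by rewrite [(1, 0) == exit_black a]eq_sym (negPf b1) [RHS]eq_sym (negPf bw).
  case: (w =P exit_white a) => [->|/eqP ww]; first by rewrite !eqxx orbT.
  by rewrite [exit_white a == w]eq_sym (negPf ww) orbF.
have : [\/ glue_vertex a v0 = (0, 0), glue_vertex a v0 = (1, 0)
    | [/\ glue_vertex a v0 = v0, v0 != exit_black a & v0 != exit_white a]].
  rewrite /glue_vertex; case: eqP => [_|/eqP vb]; first exact: Or31.
  by case: eqP => [_|/eqP vw]; [exact: Or32 | exact: Or33].
case=> [->//|->//|[-> vb vw]].
have [->//|/eqP v00] := v0 =P (0, 0); have [->//|/eqP v01] := v0 =P (1, 0).
have hinc e : incident (band a) v0 e = incident (snake a) v0 e.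
  have hg w : (v0 == glue_vertex a w) = (v0 == w).
    rewrite /glue_vertex; case: (w =P exit_black a) => [->|_].
      by rewrite (negPf v00) (negPf vb).
    by case: (w =P exit_white a) => [->|//]; rewrite (negPf v01) (negPf vw).
  by rewrite /incident /= !hg.
have [e0 e0P h0] := perfect_unique hP hv0.
apply/eqP/cardfs1P; exists e0; apply/fsetP => e; rewrite in_fset1 !inE /= hinc.
rewrite mem_matching_image //.
have e0E : e0 != entry_edge.
  apply/eqP => h; have := h0 _ e0P.
  by rewrite {1}h incE (negPf v00) (negPf v01) eqxx.
have e0X : e0 != exit_edge a.
  apply/eqP => h; have := h0 _ e0P.
  by rewrite {1}h incX (negPf vb) (negPf vw) eqxx.
case: (e =P entry_edge) => [->|_].
  by rewrite incE (negPf v00) (negPf v01) andbF eq_sym (negPf e0E).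
case: (boolP (e \in P)) => [eP|eP] /=; last by apply/esym/eqP => h; rewrite h e0P in eP.
by rewrite h0 //; case: (e =P e0) => [->|]; rewrite ?andbF // e0X.
Qed.

(** * Good matchings as monotone functions on a circular fence *)

Definition cyclic_pred n k := if k is k'.+1 then k' else n.-1.

Lemma cyclic_predE n k : cyclic_pred n k = if k == 0 then n.-1 else k.-1.
Proof. by case: k. Qed.

Lemma cyclic_pred_lt n k : k < n -> cyclic_pred n k < n.
Proof. by case: k => [|k] /=; lia. Qed.

(** The circular fence: tiles [k.-1] and [k], with tile [0] preceded by the last
    one, are comparable, in a direction that depends on the parity of the block
    of tile [k]. *)
Definition fence_monotone (a : seq nat) (g : nat -> nat) := forall k, k < sumn a ->
  if block_parity a k then g (cyclic_pred (sumn a) k) <= g k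
  else g k <= g (cyclic_pred (sumn a) k).

(** The multiplicities of the edges of the good [m]-dimer cover given by a
    monotone [g] bounded by [m]. The last case is that of [upper a k.-1], which
    starts at level [k]. All multiplicities are affine in [g], which makes them
    additive under sums of matchings. *)
Definition cover_mult (a : seq nat) (m : nat) (g : nat -> nat)
    (e : nat * nat * bool) : nat :=
  let k := level e.1 in
  let p := g (cyclic_pred (sumn a) k) in
  if e.1 == tile a k then
    if e.2 == dir a k then (if block_parity a k then m - g k else g k)
    else (if block_parity a k then g k - p else p - g k)
  else (if block_parity a k then p else m - p).

Section Mult.
Variables (a : seq nat) (m : nat) (g : nat -> nat).

Lemma cover_mult_lower k :
  cover_mult a m g (lower a k) = if block_parity a k then m - g k else g k.
Proof. by rewrite /cover_mult /= level_tile !eqxx. Qed.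

Lemma cover_mult_rung k : cover_mult a m g (rung a k) =
  if block_parity a k then g k - g (cyclic_pred (sumn a) k)
  else g (cyclic_pred (sumn a) k) - g k.
Proof.
by rewrite /cover_mult /= level_tile eqxx; case: (dir a k).
Qed.

Lemma cover_mult_upper k :
  cover_mult a m g (upper a k) = if block_parity a k.+1 then g k else m - g k.
Proof.
rewrite /cover_mult /= level_step level_tile tileS.
by rewrite (negPf (step_neq _ _)).
Qed.
End Mult.

Section GoodMatchings.

Variable a : seq nat.
Hypothesis size_gt1 : 1 < size a.
Hypothesis a_pos : all (fun x => 0 < x) a.

Lemma ntiles_gt1 : 1 < sumn a.
Proof.
move: size_gt1 a_pos; case: a => [|x [|y s]] //= _ /and3P[hx hy _]; lia.
Qed.
Let N0 : 0 < sumn a := ltnW ntiles_gt1.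

Lemma block_parity0 : block_parity a 0 = false.
Proof.
have /block_ofP[_ h _] := N0; rewrite /block_parity.
move: size_gt1 a_pos h; case: a => [|x s] //= _ /andP[hx _].
by case: (block_of _ 0) => [|b] //=; lia.
Qed.

(** The path turns at tile [k] unless this tile ends its block. *)
Lemma dir_turn k : k < sumn a ->
  (dir a k != dir a k.+1) = (block_parity a k == block_parity a k.+1).
Proof.
move=> hk; rewrite /block_parity block_of_succ // oddD oddb.
have -> : dir a k.+1 = (if last_in_block a k then dir a k else ~~ dir a k) by [].
by case: last_in_block (dir a k) (odd _) => -[] [].
Qed.

Lemma band_edge_cases e : e \in edges (band a) ->
  exists2 k, k < sumn a & [\/ e = rung a k, e = lower a k | e = upper a k].
Proof.
rewrite mem_band_edges // exit_edgeE // => /andP[/snake_edge_cases].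
case=> [[he hl]|[he hl]|[k [hl hk he]]] hx.
- exists (level e.1); last exact: Or31.
  rewrite ltn_neqAle hl andbT; apply: contra_neq hx => h.
  by rewrite he h.
- by exists (level e.1); last exact: Or32.
- by exists k; last exact: Or33.
Qed.

Lemma lower_band k : k < sumn a -> lower a k \in edges (band a).
Proof.
move=> hk; rewrite mem_band_edges // (lower_snake hk) exit_edgeE //.
by rewrite eq_sym rung_neq_lower.
Qed.

Hypothesis size_even : ~~ odd (size a).

(** An even number of blocks makes the fence close up: the comparison at the
    glued edge has the same direction seen from either end of the snake. *)
Lemma block_parityN : block_parity a (sumn a) = false.
Proof. by rewrite /block_parity block_of_sumn; apply: negbTE. Qed.

Section Encode.
Variables (P : {fset nat * nat * bool}) (chi : nat -> bool).
Hypothesis hP : P \in perfect_matchings (snake a).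
Hypothesis hchi : forall k, k < sumn a ->
  (lower a k \in P) = chi k (+) block_parity a k.

(** Under the change of variables [chi], the lower edge of tile [k] sees the
    parity of the block of tile [k], and its upper edge sees that of tile
    [k.+1], because these parities agree exactly when the path turns. *)
Lemma mem_upper k : k < sumn a -> (upper a k \in P) = chi k (+) ~~ block_parity a k.+1.
Proof.
move=> hk; have /perfect_snakeP[//|_ hup _] := hP.
rewrite hup // hchi // dir_turn //.
by case: (chi k) (block_parity a k) (block_parity a k.+1) => -[] [].
Qed.

(** The edges [upper a k], [lower a k.+1] and [rung a k.+1] join the same levels,
    so only one of them is in [P]. Expressed with [chi], the first two are
    both in [P] when [chi k] and [chi k.+1] violate the order of the fence, and
    both absent, which leaves room for the rung, when the values differ in the
    allowed direction. *)
Lemma mem_rung_succ k : k.+1 < sumn a ->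
  if block_parity a k.+1 then chi k <= chi k.+1 /\ (rung a k.+1 \in P) = chi k.+1 - chi k :> nat
  else chi k.+1 <= chi k /\ (rung a k.+1 \in P) = chi k - chi k.+1 :> nat.
Proof.
move=> hk; have /perfect_snakeP[//|_ _ hb] := hP.
have := hb _ (ltnW hk); rewrite /balanced /= mem_upper ?(ltnW hk) // hchi //.
by case: (rung a k.+1 \in P); case: (chi k) (chi k.+1) (block_parity a k.+1) => -[] [].
Qed.

Lemma mem_entry : (entry_edge \in P) = ~~ chi 0.
Proof.
have /perfect_snakeP[//|_ _ hb] := hP.
have := hb 0 isT; rewrite /balanced /= (entry_edgeE a) hchi // block_parity0 addbF.
by case: (chi 0); case: (rung a 0 \in P).
Qed.

Lemma mem_exit : (exit_edge a \in P) = chi (sumn a).-1.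
Proof.
have /perfect_snakeP[//|sub _ hb] := hP.
have := hb _ (leqnn _); rewrite /balanced exit_edgeE //.
have -> : lower a (sumn a) \in P = false.
  by apply/negbTE; apply: contra (fsubsetP sub _) (lower_exit_notin a).
have -> : upper_pred a P (sumn a) = ~~ chi (sumn a).-1.
  rewrite -[in LHS](prednK N0) /= mem_upper prednK // block_parityN.
  by rewrite addbT.
by case: (rung a (sumn a) \in P) (chi _) => -[].
Qed.

(** Inside the snake, monotonicity holds for every perfect matching. At the
    glued edge, [mem_entry] and [mem_exit] show that it fails exactly for the
    matchings which avoid both copies of that edge. *)
Lemma fence_monotone_glued : (entry_edge \in P) || (exit_edge a \in P) <->
  fence_monotone a chi.
Proof.
rewrite mem_entry mem_exit; split.
  move=> h [|k] hk; first by rewrite block_parity0 /=; case: (chi 0) h => //= ->.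
  by have := mem_rung_succ hk; rewrite /=; case: ifP => _ [].
by move=> /(_ 0 N0); rewrite block_parity0 /=; case: (chi 0) => //=; case: (chi _).
Qed.

(** At the glued edge, the multiplicity is one less than the number of its two
    copies in [P], that is
    [(1 - chi 0) + chi (sumn a).-1 - 1 = chi (sumn a).-1 - chi 0]. *)
Lemma matching_image_mult e : fence_monotone a chi -> e \in edges (band a) ->
  (e \in matching_image a P) = cover_mult a 1 chi e :> nat.
Proof.
move=> /(_ 0 N0); rewrite block_parity0 /= => h0 he.
rewrite mem_matching_image //.
have -> : e != exit_edge a by move: he; rewrite mem_band_edges // => /andP[].
rewrite andbT; case/band_edge_cases: he => k hk [] ->.
- rewrite (entry_edgeE a) (inj_eq (@rung_inj a)) cover_mult_rung -(entry_edgeE a).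
  case: k hk => [|k] hk /=.
    rewrite mem_entry mem_exit block_parity0.
    by move: h0; case: (chi 0); case: (chi (sumn a).-1).
  by have := mem_rung_succ hk; case: ifP => _ [].
- rewrite (entry_edgeE a) eq_sym (negPf (rung_neq_lower _ _ _)) cover_mult_lower hchi //.
  by case: (chi k) (block_parity a k) => -[].
- rewrite (entry_edgeE a) eq_sym (negPf (rung_neq_upper _ _ _)) cover_mult_upper mem_upper //.
  by case: (chi k) (block_parity a k.+1) => -[].
Qed.

End Encode.

Lemma good_matching_encode Q : Q \in good_matchings a ->
  exists2 chi : nat -> bool, fence_monotone a chi &
    forall e, e \in edges (band a) -> (e \in Q) = cover_mult a 1 chi e :> nat.
Proof.
rewrite /good_matchings in_fset inE /= => /andP[_ /imfsetP[P /= /andP[hP hor] ->]].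
change (is_true (P \in perfect_matchings (snake a))) in hP.
pose chi k := (lower a k \in P) (+) block_parity a k.
have hchi k : k < sumn a -> (lower a k \in P) = chi k (+) block_parity a k.
  by move=> _; rewrite /chi addbK.
have hmon : fence_monotone a chi := proj1 (fence_monotone_glued hP hchi) hor.
by exists chi => // e he; apply: matching_image_mult.
Qed.

Lemma good_matching_decode (chi : nat -> bool) : fence_monotone a chi ->
  exists2 Q, Q \in good_matchings a &
    forall e, e \in edges (band a) -> (e \in Q) = cover_mult a 1 chi e :> nat.
Proof.
move=> hmon.
(* [low k] and [upp k.+1] prescribe the lower and upper edges of tile [k]; the
   rungs are then forced by the invariant [balanced]. *)
pose low k := (k < sumn a) && (chi k (+) block_parity a k).
pose upp k := if k is k'.+1 then chi k' (+) ~~ block_parity a k else false.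
pose memP (e : nat * nat * bool) := let k := level e.1 in
  if e.1 == tile a k then if e.2 == dir a k then low k else ~~ low k && ~~ upp k
  else upp k.
pose P := [fset e in edges (snake a) | memP e]%fset.
have PE e : (e \in P) = (e \in edges (snake a)) && memP e by rewrite in_fset.
have Plow k : k < sumn a -> (lower a k \in P) = chi k (+) block_parity a k.
  by move=> hk; rewrite PE lower_snake // /memP /= level_tile !eqxx /low hk.
have Prung k : k <= sumn a -> (rung a k \in P) = ~~ low k && ~~ upp k.
  move=> hk; rewrite PE rung_snake // /memP /= level_tile eqxx.
  by case: (dir a k).
have Pupp k : k < sumn a -> (upper a k \in P) = upp k.+1.
  move=> hk; rewrite PE upper_snake // /memP /= level_step level_tile tileS.
  by rewrite (negPf (step_neq _ _)).
(* This is where monotonicity is used: the invariant leaves room for the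
   rung. *)
have hlu k : k <= sumn a -> ~~ (low k && upp k).
  case: k => [|k] hk; first by rewrite andbF.
  rewrite /low /upp; case: (ltnP k.+1 (sumn a)) => //= hk1.
  have := hmon _ hk1; rewrite /=.
  by case: (chi k) (chi k.+1) (block_parity a k.+1) => -[] [].
have hP : P \in perfect_matchings (snake a).
  apply/perfect_snakeP => //; split.
  - by apply/fsubsetP => e; rewrite PE => /andP[].
  - move=> k hk; rewrite Pupp // Plow // dir_turn // /upp.
    by case: (chi k) (block_parity a k) (block_parity a k.+1) => -[] [].
  - move=> k hk; rewrite /balanced Prung //.
    have -> : lower a k \in P = low k.
      case: (ltnP k (sumn a)) => hk1; first by rewrite Plow // /low hk1.
      have -> : k = sumn a by apply/eqP; rewrite eqn_leq hk.
      rewrite /low ltnn; apply/negbTE; rewrite PE negb_and.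
      by rewrite (lower_exit_notin a).
    have -> : upper_pred a P k = upp k by case: k hk => // k hk; exact: Pupp.
    by have := hlu _ hk; case: (low k) (upp k) => -[].
have hor : (entry_edge \in P) || (exit_edge a \in P).
  exact: (proj2 (fence_monotone_glued hP Plow) hmon).
exists (matching_image a P).
  rewrite /good_matchings in_fset inE /= matching_image_perfect ?ntiles_gt1 //=.
  by apply/imfsetP; exists P => //=; apply/andP; split.
by move=> e he; apply: matching_image_mult.
Qed.

End GoodMatchings.

(** * Good dimer covers as bounded functions on a circular fence *)

Lemma sum_layers m x : x <= m -> \sum_(t < m) (t < x) = x.
Proof.
move=> hx; rewrite -[RHS](card_ord x) -sum1_card (big_ord_widen m (fun=> 1)) //.
by rewrite [RHS]big_mkcond; apply: eq_bigr => t _; case: ifP.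
Qed.

Section Covers.

Variables (a : seq nat) (m : nat).
Hypothesis size_gt1 : 1 < size a.
Hypothesis a_pos : all (fun x => 0 < x) a.

Definition fence_fun := {ffun 'I_(sumn a) -> 'I_m.+1}.

(** Extension by zero, so that neighbours can be named by natural numbers. *)
Definition height (f : fence_fun) (k : nat) : nat :=
  if insub k is Some i then f i else 0.

Lemma heightE f (i : 'I_(sumn a)) : height f i = f i.
Proof. by rewrite /height valK. Qed.

Lemma height_le f k : height f k <= m.
Proof. by rewrite /height; case: insubP => // i _ _; rewrite -ltnS. Qed.

Lemma height_finfun (g : nat -> nat) k : k < sumn a -> g k <= m ->
  height [ffun i : 'I_(sumn a) => inord (g i)] k = g k.
Proof. by move=> hk hg; rewrite (heightE _ (Ordinal hk)) ffunE inordK. Qed.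

Definition fence_partition (f : fence_fun) : bool :=
  [forall k : 'I_(sumn a),
    if block_parity a k then height f (cyclic_pred (sumn a) k) <= height f k
    else height f k <= height f (cyclic_pred (sumn a) k)].

Lemma fence_partitionP f : reflect (fence_monotone a (height f)) (fence_partition f).
Proof.
apply: (iffP forallP) => h; last first.
  by move=> k; have := h k (ltn_ord k); case: ifP.
by move=> k hk; have := h (Ordinal hk); rewrite /=; case: ifP.
Qed.

Lemma eq_fence_monotone (g h : nat -> nat) : (forall k, k < sumn a -> g k = h k) ->
  fence_monotone a g -> fence_monotone a h.
Proof. by move=> E hg k hk; rewrite -!E ?cyclic_pred_lt //; exact: hg. Qed.

Lemma eq_cover_mult (g h : nat -> nat) e : (forall k, k < sumn a -> g k = h k) ->
  e \in edges (band a) -> cover_mult a m g e = cover_mult a m h e.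
Proof.
move=> E he; have [k hk [] ->] := band_edge_cases size_gt1 a_pos he.
- by rewrite !cover_mult_rung !E ?cyclic_pred_lt.
- by rewrite !cover_mult_lower !E.
- by rewrite !cover_mult_upper !E.
Qed.

Definition cover_of (f : fence_fun) : edge_multiset a :=
  [ffun e => cover_mult a m (height f) (val e)].

Lemma fence_monotone_sum (chi : 'I_m -> nat -> bool) :
  (forall t, fence_monotone a (chi t)) ->
  fence_monotone a (fun k => \sum_(t < m) chi t k).
Proof.
move=> h k hk; case: ifP => hb; apply: leq_sum => t _.
  by have := h t k hk; rewrite hb.
by have := h t k hk; rewrite hb.
Qed.

Lemma cover_mult_sum (chi : 'I_m -> nat -> bool) e :
  (forall t, fence_monotone a (chi t)) -> e \in edges (band a) ->
  \sum_(t < m) cover_mult a 1 (chi t) e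
  = cover_mult a m (fun k => \sum_(t < m) chi t k) e.
Proof.
move=> h he; have [k hk {}he] := band_edge_cases size_gt1 a_pos he.
have compl k' : \sum_(t < m) (1 - chi t k') = m - \sum_(t < m) chi t k'.
  rewrite sumnB; last by move=> t _; case: (chi t k').
  by rewrite sum_nat_const card_ord muln1.
case: he => ->.
- under eq_bigr do rewrite cover_mult_rung.
  rewrite cover_mult_rung; case: ifP => hb; rewrite sumnB // => t _.
    by have := h t k hk; rewrite hb.
  by have := h t k hk; rewrite hb.
- under eq_bigr do rewrite cover_mult_lower.
  by rewrite cover_mult_lower; case: ifP.
- under eq_bigr do rewrite cover_mult_upper.
  by rewrite cover_mult_upper; case: ifP.
Qed.

Lemma cover_of_inj : injective cover_of.
Proof.
move=> f f' /ffunP E; apply/ffunP => i; apply/val_inj.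
have := E [` lower_band size_gt1 a_pos (ltn_ord i)]%fset.
rewrite !ffunE [LHS]cover_mult_lower [RHS]cover_mult_lower !heightE.
by have := ltn_ord (f i); have := ltn_ord (f' i); case: ifP; rewrite /=; lia.
Qed.

(** The function of a sum of good matchings is the sum of their functions.
    Conversely a monotone function [f] with values at most [m] is the sum of the
    [m] indicators of [t < f], each of which is monotone and comes from a good
    matching. *)
Lemma good_dimer_coverP M : ~~ odd (size a) ->
  reflect (exists2 f, fence_partition f & M = cover_of f)
    (M \in good_dimer_covers a m).
Proof.
move=> size_even; apply: (iffP (imfsetP _ _ _ _)) => [[P _ ->]|[f /fence_partitionP hf ->]].
  have /fin_all_exists2[chi hmon hchi] (t : 'I_m) :
      exists2 chi : nat -> bool, fence_monotone a chi &
      forall e, e \in edges (band a) -> (e \in val (P t)) = cover_mult a 1 chi e :> nat.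
    by apply: good_matching_encode => //; exact: valP.
  pose g k := \sum_(t < m) chi t k.
  have gm k : g k <= m.
    rewrite -[leqRHS]card_ord -sum1_card; apply: leq_sum => t _; exact: leq_b1.
  have hE k : k < sumn a -> g k = height [ffun i : 'I_(sumn a) => inord (g i)] k.
    by move=> hk; rewrite height_finfun.
  exists [ffun i : 'I_(sumn a) => inord (g i)].
    by apply/fence_partitionP; apply: eq_fence_monotone hE _; exact: fence_monotone_sum.
  apply/ffunP => e; rewrite !ffunE -(eq_cover_mult hE) ?fsvalP //.
  rewrite -cover_mult_sum //; last exact: fsvalP.
  by apply: eq_bigr => t _; rewrite hchi //; exact: fsvalP.
pose chi (t : 'I_m) k := t < height f k.
have hmon t : fence_monotone a (chi t).
  by move=> k hk; have := hf k hk; rewrite /chi; case: ifP => _; lia.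
have /fin_all_exists[Q hQ] (t : 'I_m) : exists Q : good_matchings a,
    forall e, e \in edges (band a) -> (e \in val Q) = cover_mult a 1 (chi t) e :> nat.
  have [Q QG hQ] := good_matching_decode size_gt1 a_pos size_even (hmon t).
  by exists [` QG]%fset.
exists (finfun Q) => //; apply/ffunP => e; rewrite !ffunE.
under eq_bigr do rewrite ffunE hQ ?fsvalP //.
rewrite cover_mult_sum //; last exact: fsvalP.
apply: eq_cover_mult; last exact: fsvalP.
by move=> k _; rewrite sum_layers // height_le.
Qed.

(** The reflection of the circle that exchanges the ends of the first block.
    Relation [k] is the comparison between tile [k] and its predecessor;
    a reflection also exchanges these two tiles, hence the shift by one between
    its actions on relations and on tiles. *)
Definition reflect_relation k :=
  if k < head 0 a then head 0 a - k.+1 else sumn a + head 0 a - k.+1.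

Definition reflect_tile k := cyclic_pred (sumn a) (reflect_relation k).

Lemma head_le : head 0 a <= sumn a.
Proof. by case: a => //= x s; exact: leq_addr. Qed.

Lemma head_gt0 : 0 < head 0 a.
Proof. by move: size_gt1 a_pos; case: a => //= x s _ /andP[]. Qed.

Lemma reflect_relation_lt k : k < sumn a -> reflect_relation k < sumn a.
Proof. have := head_le; rewrite /reflect_relation; case: ifP; lia. Qed.

Lemma reflect_tile_lt k : k < sumn a -> reflect_tile k < sumn a.
Proof. by move=> hk; rewrite cyclic_pred_lt // reflect_relation_lt. Qed.

Lemma reflect_tile_pred k : k < sumn a ->
  reflect_tile (cyclic_pred (sumn a) k) = reflect_relation k.
Proof.
have := head_le; have := head_gt0.
by rewrite /reflect_tile /reflect_relation !cyclic_predE; do ![case: ifP]; lia.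
Qed.

Lemma reflect_tileK k : k < sumn a -> reflect_tile (reflect_tile k) = k.
Proof.
have := head_le; have := head_gt0.
by rewrite /reflect_tile /reflect_relation !cyclic_predE; do ![case: ifP]; lia.
Qed.

(** A reflection of the circle reverses all comparisons, and so does
    complementation to [m]; their composition preserves monotonicity. *)
Definition reflect_fun (f : fence_fun) : fence_fun :=
  [ffun i : 'I_(sumn a) => inord (m - height f (reflect_tile i))].

Lemma height_reflect f k : k < sumn a ->
  height (reflect_fun f) k = m - height f (reflect_tile k).
Proof. by move=> hk; rewrite (heightE _ (Ordinal hk)) ffunE inordK // ltnS leq_subr. Qed.

Lemma reflect_funK : involutive reflect_fun.
Proof.
move=> f; apply/ffunP => i; apply/val_inj; rewrite /= -!heightE.
by rewrite !height_reflect ?reflect_tile_lt // reflect_tileK // subKn // height_le.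
Qed.

Lemma reflect_fun_partition f : ~~ odd (size a) -> behead a = rev (behead a) ->
  fence_partition (reflect_fun f) = fence_partition f.
Proof.
move=> size_even hpal.
have half f' : fence_partition f' -> fence_partition (reflect_fun f').
  move=> /fence_partitionP hf; apply/fence_partitionP => k hk.
  rewrite !height_reflect ?cyclic_pred_lt // reflect_tile_pred //.
  have := hf _ (reflect_relation_lt hk).
  have -> : block_parity a (reflect_relation k) = block_parity a k.
    exact: block_parity_reflect.
  rewrite -/(reflect_tile k); case: ifP => _; exact: leq_sub2l.
by apply/idP/idP => [/half|/half //]; rewrite reflect_funK.
Qed.

Definition total_height (f : fence_fun) := \sum_i (f i : nat).

Lemma total_height_reflect f :
  total_height (reflect_fun f) = sumn a * m - total_height f.
Proof.
rewrite /total_height.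
under eq_bigr do rewrite -heightE height_reflect //.
rewrite sumnB; last by move=> i _; exact: height_le.
rewrite sum_nat_const card_ord; congr (_ - _).
pose s (i : 'I_(sumn a)) : 'I_(sumn a) := Ordinal (reflect_tile_lt (ltn_ord i)).
have sK : involutive s by move=> i; apply: val_inj; rewrite /= reflect_tileK.
rewrite [RHS](reindex_inj (inv_inj sK)) /=.
by apply: eq_bigr => i _; rewrite -heightE.
Qed.

Lemma total_height_le f : total_height f <= sumn a * m.
Proof.
rewrite /total_height -[X in _ <= X * _]card_ord -sum_nat_const; apply: leq_sum => i _.
by rewrite -ltnS.
Qed.

End Covers.

(** * South-West weights and the partition function *)

(** Among the west and south edges of the tiles, exactly the edges [lower a k]
    and the edge (ab) are on the boundary. *)
Lemma lower_on_boundary a k : k < sumn a -> on_boundary a (lower a k).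
Proof.
move=> hk; rewrite /on_boundary /tiles count_map.
rewrite (eq_count (a2 := pred1 k)); last first.
  move=> j; rewrite /preim /= tile_edgesE !(inj_eq (@lower_inj a)).
  rewrite ![lower a k == rung _ _]eq_sym !(negPf (rung_neq_lower _ _ _)).
  by rewrite (negPf (lower_neq_upper _ _ _)) !orbF eq_sym.
by rewrite count_uniq_mem ?iota_uniq // mem_iota hk.
Qed.

Lemma rung_not_on_boundary a k : k.+1 < sumn a -> ~~ on_boundary a (rung a k.+1).
Proof.
move=> hk; rewrite /on_boundary /tiles count_map /ntiles.
(* The rung belongs to the tiles [k] and [k.+1]. *)
have -> : sumn a = k + (2 + (sumn a - k.+2)) by lia.
rewrite !iotaD !count_cat /= !tile_edgesE !eqxx !orbT; lia.
Qed.

Lemma sw_edgeP a b e :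
  reflect (exists2 k, k < sumn a & [/\ block_parity a k = b, on_boundary a e
      & e = lower a k \/ e = rung a k])
    (sw_edge a b e).
Proof.
have mem_sw k : (e \in [:: west_edge (tile a k); south_edge (tile a k)])
    = (e == lower a k) || (e == rung a k).
  rewrite !inE /lower /rung /west_edge /south_edge /north /east.
  by case: (dir a k) => //; rewrite orbC.
apply: (iffP existsP) => [[k /and3P[/eqP hb ho]]|[k hk [hb ho he]]].
  rewrite mem_sw => he; exists (val k); [exact: ltn_ord | split=> //].
  by case/orP: he => /eqP; [left | right].
exists (Ordinal hk); rewrite mem_sw ho [odd _]hb eqxx /=.
by case: he => ->; rewrite eqxx ?orbT.
Qed.

Import GRing.Theory.

Section Weights.
Variables (F : fieldType) (a : seq nat).
Hypothesis size_gt1 : 1 < size a.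
Hypothesis a_pos : all (fun x => 0 < x) a.

Local Open Scope ring_scope.

Lemma sw_edge_lower b k : (k < sumn a)%N ->
  sw_edge a b (lower a k) = (block_parity a k == b).
Proof.
move=> hk; apply/idP/eqP => [/sw_edgeP[l hl [<- _ [/lower_inj ->//|/eqP]]]|hb].
  by rewrite eq_sym (negPf (rung_neq_lower _ _ _)).
by apply/sw_edgeP; exists k => //; split=> //; [exact: lower_on_boundary | left].
Qed.

Lemma sw_weight_lower k : (k < sumn a)%N ->
  sw_weight F a (lower a k) = if block_parity a k then (qvar F)^-1 else qvar F.
Proof.
move=> hk; rewrite /sw_weight !sw_edge_lower // (entry_edgeE a) eq_sym.
by rewrite (negPf (rung_neq_lower _ _ _)); case: (block_parity a k).
Qed.

Lemma sw_weight_other e : (forall k, (k < sumn a)%N -> e <> lower a k) ->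
  sw_weight F a e = 1.
Proof.
move=> he; rewrite /sw_weight; case: eqP => // hE.
have no b : sw_edge a b e = false.
  apply/negbTE/negP => /sw_edgeP[k hk [_ ho [|hr]]]; first exact: he.
  case: k hk hr => [|k] hk hr; first by apply: hE; rewrite hr.
  by move: ho; rewrite hr; apply/negP; exact: rung_not_on_boundary.
by rewrite !no.
Qed.

Lemma qvar_neq0 : qvar F != 0.
Proof. by rewrite tofrac_eq0 polyX_eq0. Qed.

(** Blocks being numbered from zero, these are the tiles of the blocks of
    [a_2], [a_4], and so on. *)
Definition odd_tiles : nat := (\sum_(k < sumn a) block_parity a k)%N.

(** In an even-numbered block (counted from zero) the lower edge of tile [k] has
    weight [q] and multiplicity [f k]; in the other ones it has weight [q^-1]
    and multiplicity [m - f k]. In both cases it contributes [q ^+ f k], up to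
    the factor [q ^- m] which appears once for each tile of the second kind. *)
Lemma cover_weight m (f : fence_fun a m) :
  \prod_(e : edges (band a)) sw_weight F a (val e) ^+ cover_of f e
  = qvar F ^+ total_height f * qvar F ^- (m * odd_tiles).
Proof.
under eq_bigr do rewrite ffunE.
rewrite -(big_seq_fsetE _ _ xpredT
  (fun e => sw_weight F a e ^+ cover_mult a m (height f) e)).
set W := fun e => _.
pose s := [seq lower a (val k) | k <- enum 'I_(sumn a)].
rewrite -(@big_fset_incl _ _ _ _ [fset e in s]%fset).
- rewrite (perm_big s); last first.
    apply: uniq_perm; rewrite ?fset_uniq //.
      by rewrite map_inj_uniq ?enum_uniq // => i j /lower_inj /val_inj.
    by move=> e; rewrite !inE.
  rewrite big_map big_enum /= /total_height /odd_tiles big_distrr /=.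
  rewrite -exprVn !expr_sum -big_split; apply: eq_bigr => k _ /=.
  rewrite /W sw_weight_lower ?ltn_ord // cover_mult_lower heightE.
  case: ifP => _; rewrite ?muln0 ?expr0 ?mulr1 // muln1.
  have hm : (f k <= m)%N by rewrite -ltnS.
  by rewrite -[X in _ = _ * _ ^+ X](subnK hm) exprD mulrCA -exprMn divff ?qvar_neq0 ?expr1n ?mulr1.
- apply/fsubsetP => e; rewrite inE => /mapP[k _ ->].
  exact: (lower_band size_gt1 a_pos (ltn_ord k)).
move=> e _; rewrite inE => he; rewrite /W sw_weight_other ?expr1n //.
move=> k hk hE; move/negP: he; apply; apply/mapP.
by exists (Ordinal hk); rewrite ?mem_enum.
Qed.

Lemma good_partition_functionE m : ~~ odd (size a) ->
  good_partition_function F a m =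
  \sum_(f : fence_fun a m | fence_partition f)
     qvar F ^+ total_height f * qvar F ^- (m * odd_tiles).
Proof.
move=> heven; rewrite /good_partition_function.
pose s := [seq cover_of f | f <- enum [pred f : fence_fun a m | fence_partition f]].
rewrite (perm_big s); last first.
  apply: uniq_perm; rewrite ?fset_uniq //.
    by rewrite (map_inj_uniq (@cover_of_inj _ _ size_gt1 a_pos)) enum_uniq.
  move=> M; apply/good_dimer_coverP/mapP => // -[f hf ->]; exists f => //.
    by rewrite mem_enum.
  by rewrite mem_enum in hf.
by rewrite big_map big_enum /=; apply: eq_bigr => f _; exact: cover_weight.
Qed.

End Weights.

Local Open Scope ring_scope.

Lemma laurent_eval_sum (F : fieldType) (I : finType) (P : pred I) (h : I -> nat) k x :
  laurent_eval (\sum_(i | P i) 'X^(h i) : {poly F}) k x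
  = \sum_(i | P i) x ^+ h i * x ^- k.
Proof.
pose iota : F -> {fraction {poly F}} := @tofrac {poly F} \o @polyC F.
have -> p : laurent_eval p k x = (map_poly iota p).[x] * x ^- k by [].
rewrite (rmorph_sum (map_poly iota)) horner_sum mulr_suml; apply: eq_bigr => i _.
by rewrite /= map_polyXn hornerXn.
Qed.

Lemma cancel_monomials (K : fieldType) (x y z : K) : x != 0 -> y != 0 -> z != 0 ->
  x^-1 * z = z * z / (x * y) * (y / z).
Proof. by move=> x0 y0 z0; field; rewrite x0 y0 z0. Qed.

(** Reflection and complementation map [f] to a function of total height
    [sumn a * m - total_height f], which gives [Z(q^-1) = q^c Z(q)] with
    [c = 2 * m * odd_tiles a - sumn a * m]. *)
Lemma good_partition_function_palindromic (F : fieldType) (a : seq nat) m :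
  ~~ odd (size a) -> almost_palindromic a ->
  palindromic (good_partition_function F a m).
Proof.
move=> heven [size_gt1 a_pos hpal]; set N := sumn a; set c := (m * odd_tiles a)%N.
exists (\sum_(f : fence_fun a m | fence_partition f) 'X^(total_height f)), c.
rewrite !laurent_eval_sum good_partition_functionE //; split=> //.
exists ((c + c)%N%:Z - (N * m)%N%:Z).
rewrite (reindex_inj (inv_inj (@reflect_funK _ m size_gt1 a_pos))) /=.
under eq_bigl do rewrite reflect_fun_partition //.
rewrite mulr_sumr; apply: eq_bigr => f _.
have q0 := qvar_neq0 F; have hle := total_height_le f.
rewrite total_height_reflect // expfzDr // -exprnN -exprnP -/c -/N !exprVn.
have -> : qvar F ^+ (N * m) = qvar F ^+ (N * m - total_height f) * qvar F ^+ total_height f.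
  by rewrite -exprD subnK.
by rewrite exprD invrK; apply: cancel_monomials; rewrite expf_neq0.
Qed.

Theorem proposition4p6 (R : realType) (m n : nat) (hm : (1 <= m)%N)
  (hn : (1 <= n)%N) (a : (2 * n).-tuple nat) (ha : almost_palindromic a) :
  palindromic (good_partition_function (complex R) a m).
Proof.
apply: good_partition_function_palindromic ha.
by rewrite size_tuple mul2n odd_double.
Qed.
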